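(* Let $\mathbf C$ and $\mathbf D$ be chain complexes of finite-dimensional Hilbert spaces. Suppose that $f:\mathbf C\to\mathbf D$ is the inclusion in a strong deformation retraction and that the adjoint $f^\dagger$ is also a chain map ($d f^\dagger=f^\dagger d$). Then for any eigenvector $x$ of $\Delta^{C}$ with eigenvalue $\lambda$, $f(x)$ is an eigenvector of $\Delta^{D}$ with eigenvalue $\lambda$, and $$\mathrm{gap}(\Delta^{C})\ \ge\ \mathrm{gap}(\Delta^{D}).$$
   Context: Complexes are bounded, graded cohomologically: $\mathbf C=(C^i,d_i)$ with $d_i:C^i\to C^{i+1}$, $d_{i}d_{i-1}=0$, and each $C^i$ is a finite-dimensional complex inner product space. The Laplacian is $\Delta_i=d_i^\dagger d_i+d_{i-1}d_{i-1}^\dagger$ on $C^i$, and $\Delta^{C}=\bigoplus_i\Delta_i$ (similarly $\Delta^D$). The spectral gap $\mathrm{gap}(\Delta)$ is the smallest eigenvalue of $\Delta$ on the orthogonal complement of its kernel, i.e. the smallest nonzero eigenvalue (the minimum of the empty set being read as $+\infty$). A chain map $f:\mathbf C\to\mathbf D$ is the inclusion in a strong deformation retraction if there are a chain map $\pi:\mathbf D\to\mathbf C$ and linear maps $K:D^i\to D^{i-1}$ with $\pi f=\mathrm{Id}_{\mathbf C}$, $\mathrm{Id}_{\mathbf D}-f\pi=dK+Kd$, and $Kf=0$. *)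

(* Defs.v *)
From HB Require Import structures.
From mathcomp Require Import all_boot all_order all_algebra.
From mathcomp Require Import complex.
From mathcomp Require Import all_classical all_reals ereal.
From mathcomp Require Import zify.

Set Implicit Arguments.
Unset Strict Implicit.
Unset Printing Implicit Defensive.

Import Order.TTheory GRing.Theory Num.Theory.

Local Open Scope classical_set_scope.
Local Open Scope ring_scope.
Local Open Scope complex_scope.

Section Adjoint.
Context {R : realType} {U V : vectType R[i]}.
Variables (p : {dot U for (@Num.conj R[i])}) (q : {dot V for (@Num.conj R[i])}).

(* [adj f] is the operator [g] with <f u, v> = <u, g v>; [adjP] below shows
   that it exists, so the default value of [xget] is never used. *)
Definition adj (f : 'Hom(U, V)) : 'Hom(V, U) :=
  xget 0 [set g : 'Hom(V, U) | forall u v, q (f u) v = p u (g v)].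

Lemma adj_exists (f : 'Hom(U, V)) :
  exists g : 'Hom(V, U), forall u v, q (f u) v = p u (g v).
Proof.
pose b := vbasis {:U}.
pose t (u : U) : 'rV[R[i]]_(\dim {:U}) := \row_i p u b`_i.
pose s (v : V) : 'rV[R[i]]_(\dim {:U}) := \row_i q v (f b`_i).
have tlin : linear t.
  by move=> a u w; apply/rowP => i; rewrite !mxE linearDl linearZl_LR.
have slin : linear s.
  by move=> a u w; apply/rowP => i; rewrite !mxE linearDl linearZl_LR.
pose tL := GRing.isLinear.Build _ _ _ _ t tlin.
pose tl : {linear U -> 'rV[R[i]]_(\dim {:U})} := HB.pack t tL.
pose sL := GRing.isLinear.Build _ _ _ _ s slin.
pose sl : {linear V -> 'rV[R[i]]_(\dim {:U})} := HB.pack s sL.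
pose T := linfun tl; pose S := linfun sl.
have TE u i : T u 0 i = p u b`_i by rewrite lfunE /= mxE.
have SE v i : S v 0 i = q v (f b`_i) by rewrite lfunE /= mxE.
have bE u : u = \sum_i coord b i u *: b`_i by apply: coord_vbasis; rewrite memvf.
have kT : lker T == 0%VS.
  apply/lker0P => u w Tuw; apply/eqP; rewrite -subr_eq0 -(dnorm_eq0 p).
  rewrite {2}(bE (u - w)) linear_sumr big1 // => i _.
  rewrite linearZr_LR /=.
  have -> : p (u - w) b`_i = 0 by rewrite linearBl /= -!TE Tuw subrr.
  by rewrite mulr0.
have surT : limg T = fullv.
  apply/eqP; rewrite eqEdim subvf /= limg_dim_eq.
    by rewrite dimvf /= /dim /= mul1n.
  by rewrite (eqP kT) capv0.
exists (T^-1 \o S)%VF => u v.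
have herm (W : vectType R[i]) (h : {dot W for (@Num.conj R[i])}) x y :
    h x y = Num.conj (h y x) by rewrite (hermC h x y) expr0 mul1r.
have key (i : 'I_(\dim {:U})) : p (T^-1 (S v))%VF b`_i = q v (f b`_i).
  by rewrite -TE limg_lfunVK ?surT ?memvf // SE.
rewrite lfunE /= {1 2}(bE u) !linear_sum /= !linear_sumlz; apply: eq_bigr => i _.
by rewrite linearZ /= !linearZl_LR /= herm -key -herm.
Qed.

Lemma adjP (f : 'Hom(U, V)) u v : q (f u) v = p u (adj f v).
Proof. by rewrite /adj; case: xgetP => [g _ ->//|]; case: (adj_exists f) => g hg /(_ g). Qed.

End Adjoint.

(* The differential is indexed by source and target degrees and vanishes unless
   the target degree is the successor of the source degree; this avoids
   transporting along the equality [(i - 1) + 1 = i]. *)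
Record hcomplex (R : realType) := HComplex {
  obj :> int -> vectType R[i];
  ip : forall i, {dot obj i for (@Num.conj R[i])};
  diff : forall i j, 'Hom(obj i, obj j);
  diff_deg : forall i j, j != i + 1 -> diff i j = 0;
  diff_diff : forall i j k, (diff j k \o diff i j)%VF = 0;
  hcomplex_bounded : exists N : nat, forall i,
    (N < `|i|)%N -> \dim {: obj i} = 0%N }.

Section EigenFinite.
Import VectorInternalTheory.

Lemma End_eigen_finite (R : realType) (V : vectType R[i]) (h : 'End(V)) :
  exists s : seq R[i], forall l x, x != 0 -> h x = l *: x -> l \in s.
Proof.
pose A := f2mx h.
have [s Es] := closed_field_poly_normal (char_poly A).
exists s => l x x0 hx.
have : eigenvalue A l.
  apply/eigenvalueP; exists (v2r x).
    have := congr1 v2r hx.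
    by rewrite linearZ /= unlock /= r2vK.
  by apply: contra x0 => /eqP vx0; rewrite -(v2rK x) vx0 linear0.
rewrite eigenvalue_root_char Es (monicP (char_poly_monic A)) scale1r.
by rewrite root_prod_XsubC.
Qed.

End EigenFinite.

Lemma finite_has_min (R : realType) (S : set R) (s : seq R) :
  (forall r, S r -> r \in s) -> S !=set0 ->
  exists2 m, S m & forall r, S r -> m <= r.
Proof.
move=> Ss [r0 Sr0]; pose t := sort <=%R [seq r <- s | `[< S r >]].
have tE r : S r -> r \in t.
  by move=> Sr; rewrite mem_sort mem_filter Ss // andbT; apply/asboolP.
have tS r : r \in t -> S r by rewrite mem_sort mem_filter => /andP[/asboolP].
have : sorted <=%R t by apply: sort_sorted; exact: le_total.
case: t tE tS => [|m t] tE tS; first by have := tE _ Sr0; rewrite in_nil.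
move=> /= /(order_path_min le_trans)/allP mt.
exists m => [|r /tE]; first by apply: tS; rewrite inE eqxx.
by rewrite inE => /predU1P[->//|/mt].
Qed.

Section HComplex.
Context {R : realType}.
Implicit Types C D : hcomplex R.

Definition dadj C (i j : int) : 'Hom(C j, C i) :=
  adj (ip C i) (ip C j) (diff C i j).

Definition laplacian C (i : int) : 'End(C i) :=
  ((dadj C i (i + 1) \o diff C i (i + 1))
   + (diff C (i - 1) i \o dadj C (i - 1) i))%VF.

(* As [C] is bounded, every family [x : forall i, C i] has finite support, and
   such families are exactly the elements of the direct sum of the [C i]; the
   total Laplacian acts on them componentwise. *)
Definition eigenvector C (l : R[i]) (x : forall i, C i) : Prop :=
  (exists i, x i != 0) /\ (forall i, laplacian C i (x i) = l *: x i).

Lemma laplacian_ge0 C i (y : C i) : 0 <= ip C i (laplacian C i y) y.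
Proof.
have herm (W : vectType R[i]) (h : {dot W for (@Num.conj R[i])}) u v :
    h u v = Num.conj (h v u) by rewrite (hermC h u v) expr0 mul1r.
rewrite /laplacian lfunE /= linearDl addr_ge0 //= !lfunE /=.
  by rewrite herm /dadj -(adjP (ip C i) (ip C (i + 1))) -herm dnorm_ge0.
by rewrite (adjP (ip C (i - 1)) (ip C i)) dnorm_ge0.
Qed.

Lemma eigenvector_real C (l : R[i]) (x : forall i, C i) :
  eigenvector l x -> l = (complex.Re l)%:C /\ 0 <= complex.Re l.
Proof.
move=> [[i xi0] /(_ i) lx].
have := laplacian_ge0 (x i); rewrite lx linearZl_LR /= pmulr_lge0 ?dnorm_gt0 //.
by case: l {lx} => a b; rewrite lecE /= => /andP[/eqP -> ->].
Qed.

(* Eigenvalues are real ([eigenvector_real]), so nothing is lost in ranging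
   over real [r]; the infimum is a minimum as soon as the set is nonempty
   ([gap_attained]), and is +oo otherwise ([gap_empty]). *)
Definition nonzero_spectrum C : set R :=
  [set r | r != 0 /\ exists x, eigenvector (C := C) r%:C x].

Definition gap C : \bar R := ereal_inf [set r%:E | r in nonzero_spectrum C].

Lemma gap_attained C : nonzero_spectrum C !=set0 ->
  exists2 r, nonzero_spectrum C r &
    gap C = r%:E /\ forall r', nonzero_spectrum C r' -> r <= r'.
Proof.
have [s Ss] : exists s : seq R, forall r, nonzero_spectrum C r -> r \in s.
  have [N HN] := hcomplex_bounded C.
  have [e He] := choice (fun i => End_eigen_finite (laplacian C i)).
  exists (flatten [seq [seq complex.Re z | z <- e (k%:Z - N%:Z)] | k <- iota 0 (N + N).+1]).
  move=> r [_ [x [[i xi0] Hx]]]; apply/flatten_mapP.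
  have iN : (`|i| <= N)%N.
    rewrite leqNgt; apply: contra xi0 => /HN/eqP; rewrite dimv_eq0 => /eqP V0.
    by rewrite -memv0 -V0 memvf.
  exists (absz (i + Posz N)); first by rewrite mem_iota; lia.
  have -> : Posz (absz (i + Posz N)) - Posz N = i by lia.
  by apply/mapP; exists r%:C => //; exact: He (Hx i).
move=> /(finite_has_min Ss)[m Sm mmin]; exists m => //; split => //.
apply/eqP; rewrite eq_le; apply/andP; split.
  by apply: ereal_inf_lbound; exists m.
by apply: le_ereal_inf_tmp => _ [r Sr <-]; rewrite lee_fin mmin.
Qed.

Lemma gap_empty C : nonzero_spectrum C = set0 -> gap C = +oo%E.
Proof. by move=> S0; rewrite /gap S0 image_set0 ereal_inf0. Qed.

Definition chain_map C D (f : forall i, 'Hom(C i, D i)) : Prop :=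
  forall i j, (f j \o diff C i j)%VF = (diff D i j \o f i)%VF.

(* [K] is indexed by source and target degrees, like [diff]. *)
Definition sdr C D (f : forall i, 'Hom(C i, D i)) (g : forall i, 'Hom(D i, C i))
    (K : forall i j, 'Hom(D i, D j)) : Prop :=
  [/\ chain_map f, chain_map g,
      forall i j, j != i - 1 -> K i j = 0 &
      [/\ forall i, (g i \o f i)%VF = \1%VF,
          forall i, (\1 - (f i \o g i))%VF
            = ((diff D (i - 1) i \o K i (i - 1))
               + (K (i + 1) i \o diff D i (i + 1)))%VF &
          forall i j, (K i j \o f i)%VF = 0]].

Definition sdr_inclusion C D (f : forall i, 'Hom(C i, D i)) : Prop :=
  exists (g : forall i, 'Hom(D i, C i)) (K : forall i j, 'Hom(D i, D j)), sdr f g K.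

Definition adj_map C D (f : forall i, 'Hom(C i, D i)) (i : int) : 'Hom(D i, C i) :=
  adj (ip C i) (ip D i) (f i).

End HComplex.

(* Main.v *)
Require Import Defs.
From mathcomp Require Import all_boot all_order all_algebra.
From mathcomp Require Import complex.
From mathcomp Require Import all_classical all_reals ereal.

(** The chain map [f] commutes with [d] and, by taking the adjoint of the
    relation [d f^* = f^* d], also with [d^*].  Hence it commutes with the
    Laplacian [d^* d + d d^*] ([laplacian_comm]).  The retraction is a left
    inverse of [f], so [f] is injective and carries eigenvectors to (nonzero)
    eigenvectors with the same eigenvalue ([eigenvector_map]).  The nonzero
    spectrum of [C] is therefore contained in that of [D], and an infimum over
    a larger set is smaller. *)

Import GRing.Theory Num.Theory.

Local Open Scope ring_scope.
Local Open Scope complex_scope.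

Section Adjoints.
Context {R : realType}.

Lemma adj_adjP (U V : vectType R[i]) (p : {dot U for (@Num.conj R[i])})
    (q : {dot V for (@Num.conj R[i])}) (f : 'Hom(U, V)) u v :
  p (adj p q f v) u = q v (f u).
Proof.
have herm (W : vectType R[i]) (h : {dot W for (@Num.conj R[i])}) x y :
    h x y = Num.conj (h y x) by rewrite (hermC h x y) expr0 mul1r.
by rewrite herm -(adjP p q) -herm.
Qed.

Lemma dot_ext (U : vectType R[i]) (p : {dot U for (@Num.conj R[i])}) x y :
  (forall u, p u x = p u y) -> x = y.
Proof.
move=> xy; apply/eqP; rewrite -subr_eq0 -(dnorm_eq0 p).
by rewrite linearBr /= xy subrr.
Qed.

(** Taking adjoints of the four sides of a commuting square reverses its
    arrows; since the adjoint is an involution, the sides [f^*] and [g^*]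
    become [f] and [g]. *)
Lemma adj_square (U V W Z : vectType R[i])
    (p : {dot U for (@Num.conj R[i])}) (q : {dot V for (@Num.conj R[i])})
    (r : {dot W for (@Num.conj R[i])}) (s : {dot Z for (@Num.conj R[i])})
    (d : 'Hom(U, V)) (e : 'Hom(W, Z)) (f : 'Hom(U, W)) (g : 'Hom(V, Z)) :
  (adj q s g \o e)%VF = (d \o adj p r f)%VF ->
  (f \o adj p q d)%VF = (adj r s e \o g)%VF.
Proof.
move=> sq; apply/lfunP => y; apply: (dot_ext _ r) => u.
rewrite !comp_lfunE -(adj_adjP _ _ p r) -(adjP p q) -(adjP r s).
by rewrite -(adj_adjP _ _ q s) -!comp_lfunE sq.
Qed.

End Adjoints.

Section Laplacians.
Context {R : realType} {C D : hcomplex R}.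
Variable f : forall i, 'Hom(C i, D i).

Lemma laplacian_comm i x : chain_map f -> chain_map (adj_map f) ->
  laplacian D i (f i x) = f i (laplacian C i x).
Proof.
move=> fd fadj.
have fdE j k y : f k (diff C j k y) = diff D j k (f j y).
  by rewrite -!comp_lfunE fd.
have fdadjE j k y : f j (dadj C j k y) = dadj D j k (f k y).
  by rewrite -!comp_lfunE; congr (fun_of_lfun _ y); apply: adj_square; apply: fadj.
by rewrite /laplacian !add_lfunE !comp_lfunE linearD /= !(fdE, fdadjE).
Qed.

Lemma eigenvector_map l (x : forall i, C i) :
    (forall i, injective (f i)) -> chain_map f -> chain_map (adj_map f) ->
  eigenvector l x -> eigenvector l (fun i => f i (x i)).
Proof.
move=> finj fd fadj [[i xi0] lx]; split=> [|j].
  by exists i; rewrite -(linear0 (f i)) (inj_eq (finj i)).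
by rewrite laplacian_comm // lx linearZ.
Qed.

Lemma sdr_inclusion_inj : sdr_inclusion f -> forall i, injective (f i).
Proof.
move=> [g [K [_ _ _ [gf _ _]]]] i.
by apply: (can_inj (g := g i)) => x; rewrite -comp_lfunE gf id_lfunE.
Qed.

End Laplacians.

Theorem proposition17 (R : realType) (C D : hcomplex R)
    (f : forall i : int, 'Hom(C i, D i))
    (f_sdr : sdr_inclusion f) (f_adj : chain_map (adj_map f)) :
  (forall (l : complex R) (x : forall i : int, C i),
      eigenvector l x -> eigenvector l (fun i => f i (x i)))
  /\ (gap D <= gap C)%E.
Proof.
have fd : chain_map f by case: f_sdr => g [K []].
have eig l x := @eigenvector_map _ _ _ f l x (sdr_inclusion_inj f f_sdr) fd f_adj.
split=> //; apply/le_ereal_inf/image_subset => r [r0 [x rx]].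
by split=> //; exists (fun i => f i (x i)); apply: eig.
Qed.
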